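(* Let $p\in(0,1]$ be fixed. For each $\boldsymbol{m}\in\mathcal{P}([q])$, let $\Theta_{\boldsymbol{m}}$ be the set of all $(\beta,\boldsymbol{B})\in(0,\infty)\times\mathbb{R}^{q-1}$ such that the function $$H_{\beta,\boldsymbol{B}}(\boldsymbol{t}):=\frac\beta2\sum_{r=1}^qt_r^2+\sum_{r=1}^qB_rt_r-\sum_{r=1}^qt_r\log t_r$$ has the unique global maximizer $\boldsymbol{m}$ on the set $\mathcal{P}([q])$, and $$\boldsymbol{u}^\top\nabla^2H_{\beta,\boldsymbol{B}}(\boldsymbol{m})\boldsymbol{u}<0\quad\text{for all }\boldsymbol{u}\in T:=\Big\{\boldsymbol{u}\in\mathbb{R}^q\setminus\{\boldsymbol 0\}:\sum_{r=1}^qu_r=0\Big\}.$$ Then the product measure $\nu:=\boldsymbol{m}^N\times\mathcal{G}(N,p)$ is contiguous to the measure $\mathbb{P}^{\mathrm{ER}}_{\beta,\boldsymbol{B}}$ for every $(\beta,\boldsymbol{B})\in\Theta_{\boldsymbol{m}}$. Consequently, whenever $|\Theta_{\boldsymbol{m}}|\ge2$, under $\mathbb{P}^{\mathrm{ER}}_{\beta,\boldsymbol{B}}$ there does not exist any sequence of estimators (functions of $(\boldsymbol{X},G)$) which is consistent for $(\beta,\boldsymbol{B})$ in $\Theta_{\boldsymbol{m}}$ (i.e. which converges in probability to $(\beta,\boldsymbol{B})$ under $\mathbb{P}^{\mathrm{ER}}_{\beta,\boldsymbol{B}}$ for every $(\beta,\boldsymbol{B})\in\Theta_{\boldsymbo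l{m}}$).
   Context: Fix an integer $q\ge2$; $[q]=\{1,\dots,q\}$; $\mathcal{P}([q]):=\{\boldsymbol{v}\in[0,1]^q:\sum_{r=1}^qv_r=1\}$, identified with the probability measures on $[q]$; $\boldsymbol{m}^N$ is the $N$-fold product measure $\otimes_{i=1}^N\boldsymbol{m}$ on $[q]^N$. Convention: $B_q:=0$, $0\log0:=0$. $\nabla^2H_{\beta,\boldsymbol{B}}(\boldsymbol{t})=\mathrm{diag}((\beta-t_r^{-1})_{1\le r\le q})$ is the ambient Hessian in $\mathbb{R}^q$. Erdős–Rényi Potts model: $G=((g_{ij}))_{1\le i,j\le N}$ is the adjacency matrix of an Erdős–Rényi random graph $\mathcal{G}(N,p)$ on $[N]$ (symmetric, zero diagonal, edges independent Bernoulli($p$)), with $p$ fixed (not depending on $N$), $a_{ij}:=g_{ij}/(Np)$, and, given $G$, $\boldsymbol{X}\in[q]^N$ has conditional probability mass function $$\boldsymbol{x}\mapsto\frac1{Z_N(\beta,\boldsymbol{B};G)}\exp\Big(\frac\beta2\sum_{1\le i,j\le N}a_{ij}\mathbf 1_{x_i=x_j}+\sum_{i=1}^N\sum_{r=1}^qB_r\mathbf 1_{x_i=r}\Big),$$ with $Z_N(\beta,\boldsymbol{B};G)$ the normalizing constant. $\mathbb{P}^{\mathrm{ER}}_{\beta,\boldsymbol{B}}$ denotes the joint law of $(\boldsymbol{X},G)$ on $[q]^N\times\{0,1\}^{\binom N2}$. A sequence of measures $Q_N$ is contiguous to $P_N$ if $P_N(S_N)\to0$ implies $Q_N(S_N)\to0$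 for every sequence of events $S_N$. *)

(* Defs.v *)
From HB Require Import structures.
From mathcomp Require Import all_boot all_order all_algebra.
From mathcomp Require Import all_classical all_reals all_analysis.

Set Implicit Arguments.
Unset Strict Implicit.
Unset Printing Implicit Defensive.

Import Order.TTheory GRing.Theory Num.Theory.
Import numFieldNormedType.Exports.

Local Open Scope classical_set_scope.
Local Open Scope ring_scope.

(* Laws on a finite type are given by their mass functions. *)
Definition prob (R : realType) (T : finType) (P : T -> R) (A : {set T}) : R :=
  \sum_(w in A) P w.

Definition contiguous (R : realType) (T : nat -> finType)
    (Q P : forall N, T N -> R) : Prop :=
  forall S : (forall N, {set T N}),
    (prob (P N) (S N) @[N --> \oo] --> (0 : R)) ->
    (prob (Q N) (S N) @[N --> \oo] --> (0 : R)).

Definition cvg_in_prob (R : realType) (T : nat -> finType) (V : normedModType R)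
    (P : forall N, T N -> R) (X : forall N, T N -> V) (l : V) : Prop :=
  forall eps : R, 0 < eps ->
    (prob (P N) (finset (fun w => eps <= `|X N w - l|)) @[N --> \oo] --> (0 : R)).

(* The set {1, ..., q} is encoded as 'I_q; the ordinal q.-1 stands for q. *)
Definition simplex (R : realType) (q : nat) : set 'cV[R]_q :=
  [set v | (forall r, 0 <= v r 0 <= 1) /\ \sum_r v r 0 = 1].

(* The field B extended to [q] by the convention B_q = 0. *)
Definition field_coord (R : realType) (q : nat) (B : 'cV[R]_q.-1) (r : 'I_q) : R :=
  if insub (r : nat) is Some s then B s 0 else 0.

(* [ln 0 = 0], so 0 log 0 = 0. *)
Definition freeH (R : realType) (q : nat) (theta : R * 'cV[R]_q.-1)
    (t : 'cV[R]_q) : R :=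
  theta.1 / 2 * \sum_r t r 0 ^+ 2
  + \sum_r field_coord theta.2 r * t r 0
  - \sum_r t r 0 * ln (t r 0).

(* The ambient Hessian of [freeH]; it is only meaningful when all t_r > 0, which
   holds at every maximizer of [freeH] on the simplex, so the convention
   0^-1 = 0 plays no role. *)
Definition hessH (R : realType) (q : nat) (theta : R * 'cV[R]_q.-1)
    (t : 'cV[R]_q) : 'M[R]_q :=
  diag_mx (\row_r (theta.1 - (t r 0)^-1)).

Definition global_maximizer (R : realType) (q : nat) (theta : R * 'cV[R]_q.-1)
    (t : 'cV[R]_q) : Prop :=
  simplex t /\ forall s, simplex s -> freeH theta s <= freeH theta t.

Definition Theta (R : realType) (q : nat) (m : 'cV[R]_q) :
    set (R * 'cV[R]_q.-1) :=
  [set theta |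
    [/\ 0 < theta.1,
        global_maximizer theta m /\
          (forall t, global_maximizer theta t -> t = m) &
        forall u : 'cV[R]_q, u != 0 -> \sum_r u r 0 = 0 ->
          (u^T *m hessH theta m *m u) 0 0 < 0]].

(* Graphs on [N] as elements of {0,1}^(N choose 2), indexed by pairs i < j. *)
Definition edge (N : nat) := {e : 'I_N * 'I_N | (e.1 < e.2)%N}.
Definition graph (N : nat) := {ffun edge N -> bool}.

(* Symmetric adjacency relation with zero diagonal. *)
Definition adj (N : nat) (G : graph N) (i j : 'I_N) : bool :=
  if (insub (i, j) : option (edge N)) is Some e then G e
  else if (insub (j, i) : option (edge N)) is Some e then G e
  else false.

Definition er_pmf (R : realType) (p : R) (N : nat) (G : graph N) : R :=
  \prod_(e : edge N) (if G e then p else 1 - p).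

Definition coloring (q N : nat) := {ffun 'I_N -> 'I_q}.
Definition sample (q N : nat) : finType := (coloring q N * graph N)%type.

Definition coupling (R : realType) (p : R) (N : nat) (G : graph N) (i j : 'I_N) : R :=
  (adj G i j)%:R / (N%:R * p).

Definition potts_weight (R : realType) (p : R) (q N : nat)
    (theta : R * 'cV[R]_q.-1) (G : graph N) (x : coloring q N) : R :=
  expR (theta.1 / 2 * \sum_i \sum_j coupling p G i j * (x i == x j)%:R
        + \sum_i \sum_r field_coord theta.2 r * (x i == r)%:R).

Definition potts_Z (R : realType) (p : R) (q N : nat)
    (theta : R * 'cV[R]_q.-1) (G : graph N) : R :=
  \sum_(x : coloring q N) potts_weight p theta G x.

Definition er_potts (R : realType) (p : R) (q : nat) (theta : R * 'cV[R]_q.-1)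
    (N : nat) (w : sample q N) : R :=
  er_pmf p w.2 * (potts_weight p theta w.2 w.1 / potts_Z p theta w.2).

Definition er_product (R : realType) (p : R) (q : nat) (m : 'cV[R]_q)
    (N : nat) (w : sample q N) : R :=
  (\prod_i m (w.1 i) 0) * er_pmf p w.2.

Definition consistent (R : realType) (p : R) (q : nat) (m : 'cV[R]_q)
    (est : forall N, sample q N -> R * 'cV[R]_q.-1) : Prop :=
  forall theta, Theta m theta -> cvg_in_prob (er_potts p theta) est theta.

(* Main.v *)
Require Import Defs.
From HB Require Import structures.
From mathcomp Require Import all_boot all_order all_algebra.
From mathcomp Require Import all_classical all_reals all_analysis.
From mathcomp Require Import ring lra.

Set Implicit Arguments.
Unset Strict Implicit.
Unset Printing Implicit Defensive.

Import Order.TTheory GRing.Theory Num.Theory.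
Import numFieldNormedType.Exports.

Local Open Scope classical_set_scope.
Local Open Scope ring_scope.

(* Contiguity follows once the likelihood ratio of the Potts law to the product
   law is tight from below under the product law. Annealing over the graph
   replaces the model by the Curie-Weiss-Potts model up to bounded factors,
   because exp(a Y), with Y the centred number of monochromatic edges and
   a = beta / (N p), has bounded exponential moments. By stationarity of m, the
   Curie-Weiss weight of x equals m^N(x) times a constant times
   exp(beta / (2 N) |S_N|^2), with S_N the sum of the N vectors e_{x_i} - m. This
   factor is at least 1, and its m^N-expectation stays bounded in N: uniqueness
   and nondegeneracy of the maximizer give
   KL(t | m) >= (kappa / 2) |t - m|^2 on the simplex with some kappa > beta, which
   by Legendre duality says that e_X - m is subgaussian with variance proxy
   1 / kappa < 1 / beta. If two parameters shared m, a consistent estimator would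
   have to converge to both of them under the product law. *)

(** * Elementary bounds for exp and x log x *)

Lemma expR_le_quadratic (R : realType) (a : R) : a <= 1 / 3 ->
  expR a <= 1 + a + a ^+ 2.
Proof.
move=> ha.
(* As exp a = exp (- a / 2)^(-2) <= (1 - a / 2)^(-2), it remains to use (1 + a + a^2) (1 - a / 2)^2
   - 1 = a^2 (1 - 3 a + a^2) / 4. *)
have h1 : 1 - a / 2 <= expR (- (a / 2)) by rewrite -[leLHS]/(1 + - (a / 2)) expR_ge1Dx.
have hp : 0 < 1 - a / 2 by lra.
have -> : expR a = (expR (- (a / 2)))^-1 ^+ 2.
  rewrite -expRN opprK -expRM_natl; congr expR; lra.
have h0 := expR_gt0 (- (a / 2)).
rewrite exprVn -[leLHS]mul1r ler_pdivrMr ?exprn_gt0//.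
have h2 : (1 - a / 2) ^+ 2 <= expR (- (a / 2)) ^+ 2 by rewrite ler_sqr ?nnegrE; lra.
apply: le_trans (_ : (1 + a + a ^+ 2) * (1 - a / 2) ^+ 2 <= _); last first.
  by apply: ler_wpM2l h2; nra.
have : 0 <= a ^+ 2 * (1 - 3 * a + a ^+ 2) by apply: mulr_ge0; nra.
nra.
Qed.

Lemma ln_le_subr1 (R : realType) (x : R) : 0 < x -> ln x <= x - 1.
Proof. by move=> x0; have := @le_ln1Dx R (x - 1); rewrite addrCA subrr addr0; apply; lra. Qed.

(* The derivative of the difference of the two sides, divided by x, is
   (x - 1) (2 M - 1 - x) / (2 M x ^ 2), which has the sign of x - 1. *)
Lemma xlnx_ge_quadratic (R : realType) (M x : R) : 1 <= M -> 0 <= x -> x <= 2 * M - 1 ->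
  (x - 1) ^+ 2 / (2 * M) <= x * ln x - x + 1.
Proof.
move=> M1 x0 xM.
have [->|xn0] := eqVneq x 0.
  by rewrite mul0r sub0r sqrrN expr1n oppr0 add0r ler_pdivrMr; lra.
have {}x0 : 0 < x by rewrite lt_neqAle eq_sym xn0.
pose k := (2 * M)^-1.
pose g : R -> R := @ln R \+ (fun y => (1 - k) *: y^-1) \- (fun y => k *: y) \+ cst (2 * k - 1).
pose dg y : R := (y - 1) * (2 * M - 1 - y) / (2 * M * y ^+ 2).
have dgP (y : R) : 0 < y -> is_derive y 1 g (dg y).
  move=> y0.
  have yn0 : y != 0 by rewrite gt_eqF.
  have ? := is_derive1_ln y0.
  have ? : is_derive y 1 (fun z : R => z^-1) (- y ^- 2 *: 1) by apply: is_deriveV.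
  apply: is_derive_eq.
  rewrite /dg /k /GRing.scale /=; field; rewrite ?yn0 //=; lra.
have dI (a b : R) : 0 < a -> forall y, y \in `]a, b[ -> is_derive y 1 g (dg y).
  by move=> a0 y; rewrite in_itv /= => /andP[ay _]; apply: dgP; exact: lt_trans ay.
have gc (a b : R) : 0 < a -> {within `[a, b], continuous g}.
  move=> a0; apply: derivable_within_continuous => y.
  by rewrite in_itv /= => /andP[ay _]; case: (dgP y (lt_le_trans a0 ay)).
have gE (y : R) : 0 < y -> y * ln y - y + 1 - (y - 1) ^+ 2 / (2 * M) = y * g y.
  by move=> y0; rewrite /g /= /k /GRing.scale /=; field; rewrite gt_eqF//=; lra.
have g1 : g 1 = 0.
  by have := gE 1 ltr01; rewrite ln1 !mul1r subrr expr0n /= mul0r; lra.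
suff : 0 <= g x by move=> gx; rewrite -subr_ge0 gE// mulr_ge0// ltW.
have den (y : R) : 0 < y -> 0 < (2 * M * y ^+ 2)^-1.
  by move=> y0; rewrite invr_gt0 mulr_gt0 ?exprn_gt0//; lra.
have [x1|x1|->] := ltgtP x 1; last by rewrite g1.
- have [c] := MVT x1 (dI x 1 x0) (gc x 1 x0).
  rewrite in_itv /= g1 => /andP[xc c1] hg.
  suff : dg c * (1 - x) <= 0 by lra.
  have := den c (lt_trans x0 xc); rewrite /dg.
  move: (_^-1) => i i0.
  have : 0 <= (1 - c) * (2 * M - 1 - c) by apply: mulr_ge0; lra.
  move=> h; have := mulr_ge0 (mulr_ge0 h (ltW i0)) (_ : 0 <= 1 - x); lra.
- have [c] := MVT x1 (dI 1 x ltr01) (gc 1 x ltr01).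
  rewrite in_itv /= g1 subr0 => /andP[c1 cx] ->.
  rewrite !mulr_ge0 ?ltW ?den//; lra.
Qed.

(** For s = sqrt x > 0, x ln x = 2 s^2 ln s, and - s ln s <= 1 because ln (1 / s) < 1 / s. This
    bound gives continuity of x ln x at 0. *)
Lemma norm_xlnx_le (R : realType) (x : R) : x <= 1 ->
  `|x * ln x| <= 2 * Num.sqrt `|x|.
Proof.
move=> x1; have [x0|x0] := leP x 0; first by rewrite ln0// mulr0 normr0 mulr_ge0.
rewrite (gtr0_norm x0) ler0_norm; last by rewrite mulr_ge0_le0 ?ln_le0// ltW.
set s := Num.sqrt x; have s0 : 0 < s by rewrite sqrtr_gt0.
have -> : x = s * s by rewrite -expr2 sqr_sqrtr// ltW.
rewrite lnM ?posrE// -(ler_pM2r (_ : 0 < s^-1)) ?invr_gt0//.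
have := ln_sublinear (_ : 0 < s^-1); rewrite invr_gt0 => /(_ s0).
rewrite lnV ?posrE// => h.
have -> : - (s * s * (ln s + ln s)) / s = 2 * (s * - ln s) by field; rewrite gt_eqF.
by rewrite -mulrA ler_pM2l// ler_pM2l// ltW.
Qed.

Lemma xlnx_continuous (R : realType) : continuous (fun x : R => x * ln x).
Proof.
move=> x; have [x0|x0|->] := ltgtP x 0.
(* [ln] is 0 on the negative reals by default, so the function vanishes near x. *)
- rewrite /continuous_at ln0 ?ltW// mulr0; apply: (cvg_trans _ (@cvg_cst _ (0 : R) _ (nbhs x) _)).
  apply: near_eq_cvg; near=> y.
  rewrite ln0 ?mulr0// ltW//; near: y; exact: lt_nbhsl.
- by apply: cvgM; [exact: cvg_id | exact: continuous_ln].
- rewrite /continuous_at mul0r; apply/cvgr0Pnorm_lt => e e0.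
  have d0 : 0 < Num.min 1 ((e / 2) ^+ 2) by rewrite lt_min ltr01 exprn_gt0//; lra.
  near=> y.
  have : `|y| < Num.min 1 ((e / 2) ^+ 2).
    by near: y; exists (Num.min 1 ((e / 2) ^+ 2)) => //= z; rewrite /= sub0r normrN.
  rewrite lt_min => /andP[y1 ye].
  apply: le_lt_trans (norm_xlnx_le _) _; first exact: le_trans (ler_norm _) (ltW y1).
  suff : Num.sqrt `|y| < e / 2 by lra.
  rewrite -(ger0_norm (_ : 0 <= e / 2)); last by lra.
  by rewrite -(sqrtr_sqr (e / 2)) ltr_sqrt// exprn_gt0//; lra.
Unshelve. all: by end_near. Qed.

(** * Relative entropy near a nondegenerate maximizer *)

Lemma continuous_sum_coord (R : realType) (n : nat) (g : 'I_n -> R -> R) :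
  (forall r, continuous (g r)) ->
  continuous (fun v : 'rV[R]_n => \sum_r g r (v 0 r)).
Proof.
move=> gc; apply: continuous_big => [|r _]; first exact: add_continuous.
by move=> v; apply: continuous_comp; [exact: coord_continuous|exact: gc].
Qed.

Lemma closed_sum_coord (R : realType) (n : nat) (g : 'I_n -> R -> R) (D : set R) :
  (forall r, continuous (g r)) -> closed D ->
  closed [set v : 'rV[R]_n | D (\sum_r g r (v 0 r))].
Proof.
move=> gc cD; apply: (@preimage_closed _ _ (fun v : 'rV[R]_n => \sum_r g r (v 0 r)) D) => //.
by move=> v _; exact: continuous_sum_coord.
Qed.

(** The minimum is attained, hence positive. Row vectors match [EVT_min_rV] and [rV_compact]; the
    column vectors of the model are transposed on use. *)
Lemma compact_pos_lower_bound (R : realType) (n : nat) (A : set 'rV[R]_n)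
    (g : 'I_n -> R -> R) : compact A -> (forall r, continuous (g r)) ->
  (forall v, A v -> 0 < \sum_r g r (v 0 r)) ->
  exists2 mu : R, 0 < mu & forall v, A v -> mu <= \sum_r g r (v 0 r).
Proof.
move=> cA gc gA.
have [A0|/set0P/negP/negPn/eqP->] := pselect (A !=set0); last first.
  by exists 1.
have [c cA' cmin] := EVT_min_rV A0 cA (continuous_subspaceT (continuous_sum_coord gc)).
exists (\sum_r g r (c 0 r)); first by apply: gA; exact: set_mem.
by move=> v Av; apply: cmin; exact: mem_set.
Qed.

(** The Kullback-Leibler divergence KL(t | m), at least when m has positive entries. *)
Definition relent (R : realType) (q : nat) (t m : 'cV[R]_q) : R :=
  \sum_r t r 0 * (ln (t r 0) - ln (m r 0)).

Definition sqdist (R : realType) (q : nat) (t m : 'cV[R]_q) : R :=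
  \sum_r (t r 0 - m r 0) ^+ 2.

(** The gradient of [freeH] at m up to the additive constant -1, which vanishes against vectors of
    zero sum. *)
Definition gradH (R : realType) (q : nat) (theta : R * 'cV[R]_q.-1)
    (m : 'cV[R]_q) (r : 'I_q) : R :=
  theta.1 * m r 0 + field_coord theta.2 r - ln (m r 0).

Section Maximizer.
Variables (R : realType) (q : nat).
Implicit Types (t m u : 'cV[R]_q) (theta : R * 'cV[R]_q.-1).

Lemma simplex_of_ge0 t : (forall r, 0 <= t r 0) -> \sum_r t r 0 = 1 -> simplex t.
Proof.
move=> t0 t1; split=> // r; rewrite t0 -t1 (bigD1 r)//= lerDl.
by apply: sumr_ge0.
Qed.

Lemma simplex_ge0 t : simplex t -> forall r, 0 <= t r 0.
Proof. by case=> t01 _ r; case/andP: (t01 r). Qed.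

Lemma simplex_sumB t m : simplex t -> simplex m -> \sum_r (t r 0 - m r 0) = 0.
Proof. by case=> _ ht [_ hm]; rewrite sumrB ht hm subrr. Qed.

Lemma sqdist_ge0 t m : 0 <= sqdist t m.
Proof. by apply: sumr_ge0 => r _; rewrite sqr_ge0. Qed.

(** An exact expansion around m: the quadratic part of H has no remainder, and the entropy leaves
    its first-order part in [gradH] and the rest in [relent]. *)
Lemma freeHB theta t m : freeH theta t - freeH theta m =
  \sum_r gradH theta m r * (t r 0 - m r 0) + theta.1 / 2 * sqdist t m - relent t m.
Proof.
rewrite /freeH /sqdist /relent /gradH !mulr_sumr -!sumrN -!big_split/=.
by rewrite -sumrN -big_split; apply: eq_bigr => r _ /=; field.
Qed.

(** The entropy has infinite slope at the boundary: moving mass e to an empty colour s gains e (- ln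
    e), while the other terms lose at most a multiple of e. *)
Lemma maximizer_pos theta m : 0 < theta.1 -> global_maximizer theta m -> forall r, 0 < m r 0.
Proof.
move=> b0 [hm hmax] s; rewrite lt_neqAle eq_sym simplex_ge0// andbT.
apply/negP => /eqP ms0.
pose a := \sum_r m r 0 ^+ 2.
pose b := \sum_r field_coord theta.2 r * m r 0.
pose h := \sum_r m r 0 * ln (m r 0).
(* X is the first-order rate of loss along (1 - e) m + e delta_s without the term - e ln e; the e
   below is chosen with - ln e = |X| + 1 > X. *)
pose X := theta.1 * a + b - field_coord theta.2 s - h.
pose e := expR (- (`|X| + 1)).
have e0 : 0 < e by rewrite expR_gt0.
have e1 : e <= 1 by rewrite -expR0 ler_expR oppr_le0 addr_ge0.
have lne : ln e = - (`|X| + 1) by rewrite expRK.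
pose t : 'cV[R]_q := \col_r ((1 - e) * m r 0 + e * (r == s)%:R).
have sum1 : \sum_(r < q) (r == s)%:R = 1 :> R.
  by rewrite (bigD1 s)//= eqxx big1 ?addr0// => r /negPf->.
have ht : simplex t.
  apply: simplex_of_ge0 => [r|].
    by rewrite mxE addr_ge0 ?mulr_ge0 ?simplex_ge0 ?ler0n//; lra.
  under eq_bigr do rewrite mxE.
  by rewrite big_split/= -!mulr_sumr sum1 (proj2 hm); ring.
have ts : t s 0 = e by rewrite mxE ms0 eqxx mulr0 mulr1 add0r.
have tr r : r != s -> t r 0 = (1 - e) * m r 0.
  by move=> /negPf rs; rewrite mxE rs mulr0 addr0.
have split_s (f : 'I_q -> R) (g : 'I_q -> R) : (forall r, r != s -> g r = (1 - e) * f r) -> f s = 0 ->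
    \sum_r g r = (1 - e) * \sum_r f r + g s.
  move=> fg fs; rewrite (bigD1 s)//= [in RHS](bigD1 s)//= fs add0r mulr_sumr addrC.
  by congr (_ + _); apply: eq_bigr.
have H2 : \sum_r t r 0 ^+ 2 = (1 - e) ^+ 2 * a + e ^+ 2.
  rewrite (bigD1 s)//= ts /a [in RHS](bigD1 s)//= ms0 expr0n add0r mulr_sumr addrC.
  by congr (_ + _); apply: eq_bigr => r rs; rewrite tr// exprMn.
have HB : \sum_r field_coord theta.2 r * t r 0 = (1 - e) * b + field_coord theta.2 s * e.
  rewrite (split_s (fun r => field_coord theta.2 r * m r 0)) ?ts ?ms0 ?mulr0//.
  by move=> r rs; rewrite tr//; ring.
have Hh : \sum_r t r 0 * ln (t r 0) <= (1 - e) * h + e * ln e.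
  rewrite (bigD1 s)//= ts /h [in leRHS](bigD1 s)//= ms0 mul0r add0r mulr_sumr addrC.
  rewrite lerD2r; apply: ler_sum => r rs; rewrite tr//.
  have [->|mr0] := eqVneq (m r 0) 0; first by rewrite !mulr0 !mul0r mulr0.
  have {}mr0 : 0 < m r 0 by rewrite lt_neqAle eq_sym mr0 simplex_ge0.
  have [->|en1] := eqVneq e 1; first by rewrite subrr !mul0r.
  have e1' : 0 < 1 - e by rewrite subr_gt0 lt_neqAle en1.
  rewrite -mulrA ler_wpM2l ?(ltW e1')// ler_wpM2l ?(ltW mr0)//.
  by rewrite lnM ?posrE// gerDr ln_le0//; lra.
have a0 : 0 <= a by apply: sumr_ge0 => r _; rewrite sqr_ge0.
have := hmax t ht; rewrite /freeH H2 HB -/a -/b -/h => hle.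
have : 0 <= theta.1 / 2 * (e ^+ 2 * a + e ^+ 2).
  by rewrite mulr_ge0 ?addr_ge0 ?mulr_ge0 ?sqr_ge0//; lra.
have : 0 < e * (`|X| + 1 - X).
  by rewrite mulr_gt0//; have := ler_norm X; lra.
have : e * X = e * (theta.1 * a + b - field_coord theta.2 s - h) by [].
move: Hh hle; rewrite lne; lra.
Qed.

(** Adding the zero sum of t_r - m_r turns the summands on the right into t_r (t_r / m_r - 1), and
    ln y <= y - 1 applies. *)
Lemma relent_le_chi2 t m : (forall r, 0 < m r 0) -> simplex m -> simplex t ->
  relent t m <= \sum_r (t r 0 - m r 0) ^+ 2 / m r 0.
Proof.
move=> m0 hm ht.
rewrite -[leRHS]addr0 -[X in _ + X](simplex_sumB ht hm) -big_split/=.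
apply: ler_sum => r _; have mr := m0 r.
have -> : (t r 0 - m r 0) ^+ 2 / m r 0 + (t r 0 - m r 0) = t r 0 * (t r 0 / m r 0 - 1).
  by field; rewrite gt_eqF.
have [->|tn0] := eqVneq (t r 0) 0; first by rewrite !mul0r.
have tr : 0 < t r 0 by rewrite lt_neqAle eq_sym tn0 simplex_ge0.
by rewrite ler_pM2l// -ln_div ?posrE// ln_le_subr1// divr_gt0.
Qed.

Lemma simplex_min_gt0 m : (forall r, 0 < m r 0) ->
  exists2 d : R, 0 < d & forall r, d <= m r 0.
Proof.
move=> m0; exists (\big[Num.min/1]_r m r 0); first by apply: lt_bigmin.
by move=> r; exact: bigmin_le.
Qed.

Lemma maximizer_stationary theta m u : 0 < theta.1 -> global_maximizer theta m ->
  \sum_r u r 0 = 0 -> \sum_r gradH theta m r * u r 0 = 0.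
Proof.
move=> b0 hmax.
have m0 := maximizer_pos b0 hmax.
have [hm hle] := hmax.
suff H (v : 'cV[R]_q) : \sum_r v r 0 = 0 -> \sum_r gradH theta m r * v r 0 <= 0.
  move=> u0; apply/eqP; rewrite eq_le H//= -oppr_le0 -sumrN.
  have Nu r : (- u) r 0 = - u r 0 by rewrite mxE.
  have uN0 : \sum_r (- u) r 0 = 0.
    by rewrite (eq_bigr _ (fun r _ => Nu r)) sumrN u0 oppr0.
  by have := H _ uN0; under eq_bigr do rewrite Nu mulrN.
move=> v0; set L := \sum_r _; rewrite leNgt; apply/negP => L0.
have [d d0 dm] := simplex_min_gt0 m0.
pose K := \sum_r `|v r 0| + 1.
have sv0 : 0 <= \sum_r `|v r 0| by apply: sumr_ge0.
have K0 : 0 < K by rewrite /K; lra.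
have vK r : `|v r 0| <= K.
  by rewrite /K (bigD1 r)//= -addrA lerDl addr_ge0// sumr_ge0.
pose X := \sum_r v r 0 ^+ 2 / m r 0.
have X0 : 0 <= X by apply: sumr_ge0 => r _; rewrite divr_ge0 ?sqr_ge0 ?ltW.
(* The first bound keeps m + e v in the simplex. The second gives e X <= L / 2, so the entropy loss,
   at most e^2 X, is below the gain e L. *)
pose e := Num.min (d / K) (L / (2 * (X + 1))).
have e0 : 0 < e by rewrite lt_min !divr_gt0//; lra.
have ed : e * K <= d by rewrite -ler_pdivlMr// ge_min lexx.
have eL : e * (2 * (X + 1)) <= L by rewrite -ler_pdivlMr ?ge_min ?lexx ?orbT//; lra.
pose t := m + e *: v.
have tE r : t r 0 - m r 0 = e * v r 0 by rewrite !mxE addrC addKr.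
have ht : simplex t.
  apply: simplex_of_ge0 => [r|].
    have -> : t r 0 = m r 0 + e * v r 0 by rewrite !mxE.
    have : e * `|v r 0| <= d by apply: le_trans ed; rewrite ler_pM2l.
    have := ler_norm (- (e * v r 0)); rewrite normrN normrM (gtr0_norm e0).
    by have := dm r; lra.
  under eq_bigr do rewrite !mxE.
  by rewrite big_split/= -mulr_sumr v0 (proj2 hm) mulr0 addr0.
have := hle t ht; rewrite -subr_le0 freeHB.
have -> : \sum_r gradH theta m r * (t r 0 - m r 0) = e * L.
  by rewrite /L mulr_sumr; apply: eq_bigr => r _; rewrite tE; ring.
have := relent_le_chi2 m0 hm ht.
have -> : \sum_r (t r 0 - m r 0) ^+ 2 / m r 0 = e * (e * X).
  by rewrite /X !mulr_sumr; apply: eq_bigr => r _; rewrite tE; ring.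
have := mulr_ge0 (ltW b0) (sqdist_ge0 t m).
have : e * (e * X) <= e * (L / 2) by rewrite ler_pM2l//; nra.
have := mulr_gt0 e0 L0; lra.
Qed.

Lemma hessian_form theta m u : (u^T *m hessH theta m *m u) 0 0 =
  \sum_r (theta.1 - (m r 0)^-1) * u r 0 ^+ 2.
Proof.
rewrite /hessH mxE; apply: eq_bigr => r _.
by rewrite mul_mx_diag !mxE; ring.
Qed.

(** Strict negativity on the compact unit sphere of the tangent space is uniform there, and
    homogeneity extends it to all tangent vectors. *)
Lemma hessian_gap theta m : Theta m theta -> exists2 c : R, 0 < c &
  forall u, \sum_r u r 0 = 0 ->
    c * \sum_r u r 0 ^+ 2 <= \sum_r ((m r 0)^-1 - theta.1) * u r 0 ^+ 2.
Proof.
move=> [b0 _ hneg].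
pose g (r : 'I_q) (x : R) := ((m r 0)^-1 - theta.1) * x ^+ 2.
have sqc : continuous (fun x : R => x ^+ 2) by exact: exprn_continuous.
have gc r : continuous (g r).
  by move=> x; apply: cvgM; [exact: cvg_cst|exact: sqc].
(* The box holds every unit vector and supplies compactness; the two equations are closed
   conditions. *)
pose A := [set v : 'rV[R]_q | forall r, `[-1, 1]%classic (v 0 r)] `&`
  ([set v : 'rV[R]_q | \sum_r v 0 r = 0] `&` [set v : 'rV[R]_q | \sum_r v 0 r ^+ 2 = 1]).
have cA : compact A.
  apply: compact_closedI.
    have := @rV_compact R q (fun=> `[(-1:R), 1]%classic) (fun=> @segment_compact _ _ _). exact.
  apply: closedI.
    have := @closed_sum_coord R q (fun=> id) _ (fun=> fun=> cvg_id) (@closed_eq R 0).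
    exact.
  have := @closed_sum_coord R q (fun=> fun x => x ^+ 2) _ (fun=> sqc) (@closed_eq R 1).
  exact.
have posg (v : 'rV[R]_q) : v != 0 -> \sum_r v 0 r = 0 -> 0 < \sum_r g r (v 0 r).
  move=> vn0 sv.
  have vT0 : v^T != 0 by apply: contra_neq vn0 => h; rewrite -[v]trmxK h trmx0.
  have := hneg _ vT0; under eq_bigr do rewrite mxE; move=> /(_ sv).
  rewrite hessian_form -oppr_gt0 -sumrN.
  by under eq_bigr => r do rewrite mxE -mulNr opprB.
have [c c0 hc] : exists2 mu : R, 0 < mu & forall v, A v -> mu <= \sum_r g r (v 0 r).
  apply: compact_pos_lower_bound => // v [_ [h0 h1]]; apply: posg => //.
  apply/eqP => v0; move: h1; rewrite /= v0.
  under eq_bigr do rewrite mxE expr0n/=.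
  by rewrite big1// => /esym/eqP; rewrite oner_eq0.
exists c => // u u0.
pose s := \sum_r u r 0 ^+ 2.
have s0 : 0 <= s by apply: sumr_ge0 => r _; rewrite sqr_ge0.
rewrite -/s; have [sz|sn0] := eqVneq s 0.
  rewrite sz mulr0 sumr_ge0// => r _.
  have /allP : all (fun r => u r 0 ^+ 2 == 0) (index_enum 'I_q).
    rewrite -(@psumr_eq0 R _ _ xpredT)//; first by apply/eqP.
    by move=> i _; rewrite sqr_ge0.
  by move=> /(_ r (mem_index_enum _))/eqP->; rewrite mulr0.
have {}s0 : 0 < s by rewrite lt_neqAle eq_sym sn0.
pose k := (Num.sqrt s)^-1.
have k2 : k ^+ 2 = s^-1 by rewrite exprVn sqr_sqrtr// ltW.
pose v : 'rV[R]_q := \row_r (k * u r 0).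
have Av : A v.
  have v2 : \sum_r v 0 r ^+ 2 = 1.
    under eq_bigr do rewrite mxE exprMn.
    by rewrite -mulr_sumr k2 mulVf.
  split; last split => //=.
  - move=> r; rewrite /= in_itv /= -ler_norml -(expr_le1 (n := 2))//.
    rewrite real_normK ?num_real// -v2 (bigD1 r)//= lerDl.
    by apply: sumr_ge0 => i _; rewrite sqr_ge0.
  - by under eq_bigr do rewrite mxE; rewrite -mulr_sumr u0 mulr0.
have := hc v Av.
under eq_bigr => r do rewrite /g mxE exprMn k2 mulrCA.
by rewrite -mulr_sumr mulrC ler_pdivlMr.
Qed.

(** Apply [xlnx_ge_quadratic] to t_r / m_r with weight m_r; the linear terms sum to zero. *)
Lemma relent_ge_quadratic (M : R) t m : (forall r, 0 < m r 0) -> simplex m -> simplex t ->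
  1 <= M -> (forall r, t r 0 <= (2 * M - 1) * m r 0) ->
  \sum_r (t r 0 - m r 0) ^+ 2 / (2 * M * m r 0) <= relent t m.
Proof.
move=> m0 hm ht M1 tM.
rewrite -[leRHS]subr0 -[X in _ - X](simplex_sumB ht hm) -sumrB.
apply: ler_sum => r _; have mr := m0 r; have tr := simplex_ge0 ht r.
have mn0 : m r 0 != 0 by rewrite gt_eqF.
have := @xlnx_ge_quadratic R M (t r 0 / m r 0) M1.
rewrite divr_ge0 ?(ltW mr)// ler_pdivrMr// => /(_ isT (tM r)).
have mi : 0 < (m r 0)^-1 by rewrite invr_gt0.
rewrite -(ler_pM2l mi); congr (_ <= _).
  by field; rewrite mn0 /=; lra.
have [->|tn0] := eqVneq (t r 0) 0; first by rewrite !mul0r !sub0r oppr0 add0r opprK mulVf.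
have t0 : 0 < t r 0 by rewrite lt_neqAle eq_sym tn0.
rewrite ln_div ?posrE//; move: (ln _) (ln _) => a b; by field.
Qed.

(** By stationarity F(t) = H(m) - H(t) on the simplex. Near m the Hessian gap bounds F below by a
    multiple of the squared distance; away from m, uniqueness and compactness bound it below by a
    constant. *)
Lemma relent_gap theta m : Theta m theta -> exists2 kappa : R, theta.1 < kappa &
  forall t, simplex t -> kappa / 2 * sqdist t m <= relent t m.
Proof.
move=> hTh; have [c c0 hc] := hessian_gap hTh.
have [b0 [hmax huniq] _] := hTh.
have m0 := maximizer_pos b0 hmax.
have [hm hle] := hmax.
have [d d0 dm] := simplex_min_gt0 m0.
pose F t := relent t m - theta.1 / 2 * sqdist t m.
have FE t : simplex t -> F t = freeH theta m - freeH theta t.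
  move=> ht; rewrite -[RHS]opprB freeHB.
  have -> : \sum_r gradH theta m r * (t r 0 - m r 0) = 0.
    rewrite -[RHS](@maximizer_stationary theta m (t - m))//.
      by apply: eq_bigr => r _; rewrite !mxE.
    by under eq_bigr do rewrite !mxE; exact: simplex_sumB.
  by rewrite /F; ring.
(* The allowed ratio t_r / m_r is 2 M - 1 = 1 + c d, and (1 - 1 / M) / m_r <= c / 2, so replacing 1
   / m_r by 1 / (M m_r) costs at most half of the gap c. *)
pose M := 1 + c * d / 2.
have cd0 : 0 < c * d by rewrite mulr_gt0.
have local t : simplex t -> (forall r, t r 0 - m r 0 <= c * d * m r 0) ->
    c / 4 * sqdist t m <= F t.
  move=> ht tm.
  have := @relent_ge_quadratic M t m m0 hm ht _ _.
  have -> : 1 <= M by rewrite /M; lra.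
  move=> /(_ isT); have tm' r : t r 0 <= (2 * M - 1) * m r 0.
    by have := tm r; rewrite /M; lra.
  move=> /(_ tm') h1.
  have := hc (t - m); under eq_bigr do rewrite !mxE.
  move=> /(_ (simplex_sumB ht hm)).
  under eq_bigr do rewrite !mxE.
  under [in leRHS]eq_bigr do rewrite !mxE.
  rewrite -/(sqdist t m) => h2.
  have : \sum_r (((m r 0)^-1 - theta.1) * (t r 0 - m r 0) ^+ 2 - c / 2 * (t r 0 - m r 0) ^+ 2) / 2
     <= \sum_r ((t r 0 - m r 0) ^+ 2 / (2 * M * m r 0) - theta.1 / 2 * (t r 0 - m r 0) ^+ 2).
    apply: ler_sum => r _.
    have mr := m0 r; have mn0 : m r 0 != 0 by rewrite gt_eqF.
    have M0 : 0 < M by rewrite /M; lra.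
    have h : (1 - M^-1) / m r 0 <= c / 2.
      rewrite ler_pdivrMr//.
      have : 1 - M^-1 <= c * d / 2.
        have : 1 <= (1 + c * d / 2) * M^-1 + 0 by rewrite addr0 -/M mulfV// gt_eqF.
        have : 0 < M^-1 by rewrite invr_gt0.
        have : M^-1 <= 1 by rewrite invf_le1// /M; lra.
        nra.
      by have := dm r; nra.
    have := ler_wpM2r (sqr_ge0 (t r 0 - m r 0)) h.
    have -> : (t r 0 - m r 0) ^+ 2 / (2 * M * m r 0) =
       M^-1 / m r 0 * (t r 0 - m r 0) ^+ 2 / 2.
      by field; rewrite mn0 gt_eqF.
    lra.
  rewrite sumrB -mulr_suml sumrB -!mulr_sumr -/(sqdist t m) /F; lra.
(* A squared distance below eta forces t_r - m_r <= c d d <= c d m_r, which is the range of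
   [local]. *)
pose eta := (c * d * d) ^+ 2.
have eta0 : 0 < eta by rewrite exprn_gt0// mulr_gt0.
have far : exists2 mu : R, 0 < mu & forall t, simplex t -> eta <= sqdist t m -> mu <= F t.
  pose g (r : 'I_q) (x : R) := x * ln x - x * ln (m r 0) - theta.1 / 2 * (x - m r 0) ^+ 2.
  pose sq (r : 'I_q) (x : R) := (x - m r 0) ^+ 2.
  have sqc r : continuous (sq r).
    by move=> x; apply: (@cvg_comp _ _ _ (fun x => x - m r 0) (fun x => x ^+ 2)); 
      [apply: cvgB; [exact: cvg_id|exact: cvg_cst] | exact: exprn_continuous].
  have gc r : continuous (g r).
    move=> x; apply: cvgB; last by apply: cvgM; [exact: cvg_cst|exact: sqc].
    by apply: cvgB; [exact: xlnx_continuous | apply: cvgM; [exact: cvg_id|exact: cvg_cst]].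
  have gE (v : 'rV[R]_q) : \sum_r g r (v 0 r) = F v^T.
    rewrite /F /relent /sqdist mulr_sumr -sumrB; apply: eq_bigr => r _.
    by rewrite /g !mxE; ring.
  pose A := [set v : 'rV[R]_q | forall r, `[0, 1]%classic (v 0 r)] `&`
    ([set v : 'rV[R]_q | \sum_r v 0 r = 1] `&` [set v : 'rV[R]_q | eta <= \sum_r sq r (v 0 r)]).
  have cA : compact A.
    apply: compact_closedI.
      have := @rV_compact R q (fun=> `[(0:R), 1]%classic) (fun=> @segment_compact _ _ _).
      exact.
    apply: closedI.
      have := @closed_sum_coord R q (fun=> id) _ (fun=> fun=> cvg_id) (@closed_eq R 1).
      exact.
    have := @closed_sum_coord R q sq _ sqc (@closed_ge R eta).
    exact.
  have [mu mu0 hmu] : exists2 mu : R, 0 < mu & forall v, A v -> mu <= \sum_r g r (v 0 r).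
    apply: compact_pos_lower_bound => // v [v01 [v1 vd]].
    have hv : simplex v^T.
      split; last by under eq_bigr do rewrite mxE.
      by move=> r; have := v01 r; rewrite /= in_itv /= mxE.
    rewrite gE FE// subr_gt0 lt_neqAle hle// andbT; apply/negP => /eqP he.
    have : v^T = m by apply: huniq; split=> // s hs; rewrite he hle.
    move=> vm; move: vd; rewrite /= /sq -vm.
    under eq_bigr do rewrite mxE subrr expr0n /=.
    by rewrite big1// leNgt eta0.
  exists mu => // t ht td; rewrite -[t]trmxK -gE; apply: hmu; split; last split => /=.
  - by move=> r; rewrite /= in_itv /= mxE; case: ht.
  - by under eq_bigr do rewrite mxE; case: ht.
  - by under eq_bigr do rewrite /sq mxE.
have [mu mu0 hmu] := far.
have q1 : 0 < q%:R + 1 :> R by rewrite ltr_wpDl.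
(* The squared distance on the simplex is at most q, so mu / (q + 1) times it stays below mu; the 1
   keeps the denominator positive. *)
pose c' := Num.min (c / 4) (mu / (q%:R + 1)).
have c'0 : 0 < c' by rewrite lt_min !divr_gt0.
exists (theta.1 + 2 * c') => [|t ht]; first lra.
suff : c' * sqdist t m <= F t by rewrite /F; lra.
(* The hypothesis [near_m] is [eta <= sqdist t m], the case away from m; [far_m] is the opposite
   case. *)
have [near_m|far_m] := lerP eta (sqdist t m).
- have sq1 : sqdist t m <= q%:R + 1.
    rewrite -[q in q%:R]card_ord -sum1_card natr_sum ler_wpDr//.
    apply: ler_sum => r _; case: (ht) (hm) => t01 _ [m01 _].
    by have := t01 r; have := m01 r; nra.
  apply: le_trans (hmu t ht near_m).
  have -> : mu = mu / (q%:R + 1) * (q%:R + 1) by rewrite divfK// gt_eqF.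
  apply: ler_pM => //; [exact: ltW | exact: sqdist_ge0 | by rewrite ge_min lexx orbT].
- apply: le_trans (local t ht _) => [|r].
    by rewrite ler_wpM2r ?sqdist_ge0// ge_min lexx.
  apply: le_trans (_ : c * d * d <= _); last by rewrite ler_pM2l.
  have : (t r 0 - m r 0) ^+ 2 <= eta.
    apply: ltW; apply: le_lt_trans far_m; rewrite /sqdist (bigD1 r)//= lerDl.
    by apply: sumr_ge0 => i _; rewrite sqr_ge0.
  move=> h; apply: le_trans (ler_norm _) _.
  by rewrite -ler_sqr ?nnegrE ?real_normK ?num_real ?mulr_ge0 ?(ltW c0) ?(ltW d0).
Qed.
End Maximizer.

(** * Exponential moments of the squared deviation *)

Section ExpMoment.
Variables (R : realType) (q : nat).
Implicit Types (t m : 'cV[R]_q).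

(* Gibbs' variational principle: the cumulant generating function is the
   Legendre transform of the relative entropy, attained at the tilted law t. *)
Lemma mgf_le (kappa : R) m (s : 'I_q -> R) : 0 < kappa -> simplex m ->
  (forall r, 0 < m r 0) ->
  (forall t, simplex t -> kappa / 2 * sqdist t m <= relent t m) ->
  \sum_r m r 0 * expR (s r) <=
    expR (\sum_r s r * m r 0 + \sum_r s r ^+ 2 / (2 * kappa)).
Proof.
move=> k0 hm m0 hk; set Z := \sum_r m r 0 * expR (s r).
have Z0 : 0 < Z.
  have Zr r : 0 <= m r 0 * expR (s r) by rewrite mulr_ge0 ?expR_ge0 ?ltW.
  rewrite lt_neqAle sumr_ge0// andbT eq_sym; apply/eqP => Z0.
  have : \sum_r m r 0 = 0.
    apply: big1 => r _; move/eqP: Z0; rewrite psumr_eq0//.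
    move=> /allP/(_ r (mem_index_enum _))/=.
    by rewrite mulf_eq0 (gt_eqF (expR_gt0 _)) orbF => /eqP.
  by rewrite (proj2 hm) => /eqP; rewrite oner_eq0.
pose t : 'cV[R]_q := \col_r (m r 0 * expR (s r) / Z).
have t0 r : 0 < t r 0 by rewrite mxE divr_gt0 ?mulr_gt0 ?expR_gt0.
have t1 : \sum_r t r 0 = 1.
  by under eq_bigr do rewrite mxE; rewrite -mulr_suml divff ?gt_eqF.
have ht : simplex t by apply: simplex_of_ge0 => // r; exact: ltW.
have rE : relent t m = \sum_r t r 0 * s r - ln Z.
  rewrite -[ln Z]mul1r -t1 mulr_suml -sumrB; apply: eq_bigr => r _.
  rewrite -mulrBr; congr (_ * _).
  rewrite mxE ln_div ?posrE ?mulr_gt0 ?expR_gt0// lnM ?posrE ?expR_gt0// expRK.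
  by ring.
(* Thus ln Z = sum_r t_r s_r - KL(t | m). Bounding KL below by the quadratic term and completing the
   square in t - m gives the claim. *)
rewrite -[leLHS](lnK (_ : Z \is Num.pos)) ?posrE// ler_expR.
have := hk t ht; rewrite rE.
have : \sum_r t r 0 * s r - kappa / 2 * sqdist t m <=
   \sum_r s r * m r 0 + \sum_r s r ^+ 2 / (2 * kappa).
  rewrite /sqdist mulr_sumr -sumrB -big_split; apply: ler_sum => r _ /=.
  rewrite -subr_ge0.
  have -> : s r * m r 0 + s r ^+ 2 / (2 * kappa) - (t r 0 * s r - kappa / 2 * (t r 0 - m r 0) ^+ 2)
     = (kappa * (t r 0 - m r 0) - s r) ^+ 2 / (2 * kappa).
    by field; rewrite gt_eqF.
  by rewrite divr_ge0 ?sqr_ge0//; lra.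
lra.
Qed.

Definition deviation (m : 'cV[R]_q) (N : nat) (x : coloring q N) (r : 'I_q) : R :=
  \sum_i ((x i == r)%:R - m r 0).

Lemma sum_mul_eq (f : 'I_q -> R) (a : 'I_q) : \sum_r f r * (a == r)%:R = f a.
Proof.
rewrite (bigD1 a)//= eqxx mulr1 big1 ?addr0// => r ra.
by rewrite eq_sym (negPf ra) mulr0.
Qed.

(** Independence under m^N factors the expectation into N equal one-site terms; centring by c
    removes the linear part of [mgf_le]. *)
Lemma deviation_mgf_le (kappa : R) m (N : nat) (s : 'I_q -> R) : 0 < kappa -> simplex m ->
  (forall r, 0 < m r 0) ->
  (forall t, simplex t -> kappa / 2 * sqdist t m <= relent t m) ->
  \sum_(x : coloring q N) (\prod_i m (x i) 0) * expR (\sum_r s r * deviation m x r)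
    <= expR (N%:R * (\sum_r s r ^+ 2 / (2 * kappa))).
Proof.
move=> k0 hm m0 hk.
pose c := \sum_r s r * m r 0.
have -> : \sum_(x : coloring q N) (\prod_i m (x i) 0) * expR (\sum_r s r * deviation m x r)
   = \prod_(i < N) \sum_a m a 0 * expR (s a - c).
  rewrite bigA_distr_bigA; apply: eq_bigr => x _.
  rewrite big_split/=; congr (_ * _).
  rewrite -expR_sum; congr expR.
  under eq_bigr do rewrite mulr_sumr.
  rewrite exchange_big; apply: eq_bigr => i _ /=.
  under eq_bigr do rewrite mulrBr.
  by rewrite sumrB sum_mul_eq.
rewrite prodr_const card_ord expRM_natl lerXn2r ?nnegrE ?expR_ge0//.
  by apply: sumr_ge0 => a _; rewrite mulr_ge0 ?expR_ge0 ?ltW.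
under eq_bigr do rewrite expRD mulrA.
rewrite -[leLHS]mulr_suml expRN ler_pdivrMr ?expR_gt0// -expRD addrC.
exact: mgf_le.
Qed.

End ExpMoment.

(** * Linearizing a Gaussian exponential over an integer grid *)

Section Grid.
Variable R : realType.

(** Sign and magnitude encode the integers from -M to M. Zero occurs twice, which is harmless for
    upper bounds. *)
Definition grid (M : nat) (j : bool * 'I_M.+1) : R := (-1) ^+ j.1 * j.2%:R.

(** Truncating beta v towards 0 gives a grid point k with |k - beta v| <= 1, and beta v^2 / 2 = k v
    - k^2 / (2 beta) + (k - beta v)^2 / (2 beta). *)
Lemma expR_sqr_le_grid (beta v : R) (M : nat) : 0 < beta -> `|beta * v| < M.+1%:R ->
  expR (beta / 2 * v ^+ 2) <= expR (1 / (2 * beta)) *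
    \sum_j expR (grid (M := M) j * v - grid j ^+ 2 / (2 * beta)).
Proof.
move=> b0 vM.
have n0 : 0 <= `|beta * v| by [].
have /andP[n1 n2] := truncn_itv n0.
have nM : (Num.truncn `|beta * v|%R < M.+1)%N.
  by rewrite -(ltr_nat R); exact: le_lt_trans vM.
pose j : bool * 'I_M.+1 := (beta * v < 0, Ordinal nM).
rewrite (bigD1 j)//= mulrDr ler_wpDr//.
  by rewrite mulr_ge0 ?expR_ge0 ?sumr_ge0// => i _; rewrite expR_ge0.
rewrite -expRD ler_expR.
have -> : beta / 2 * v ^+ 2 = grid j * v - grid j ^+ 2 / (2 * beta)
    + (grid j - beta * v) ^+ 2 / (2 * beta).
  by field; rewrite gt_eqF.
rewrite addrC lerD2r ler_pM2r ?invr_gt0; last lra.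
rewrite -[leLHS]real_normK ?num_real// expr_le1//.
have -> : grid j - beta * v = (-1) ^+ (beta * v < 0)%R * ((Num.truncn `|beta * v|)%:R - `|beta * v|).
  by rewrite mulrBr -numEsign.
rewrite normrM normr_sign mul1r ler_norml.
by move: n2; rewrite -addn1 natrD; lra.
Qed.

(** As k^2 >= |k|, each sign contributes at most a geometric series, so the bound is uniform in
    M. *)
Lemma sum_grid_le (c : R) (M : nat) : 0 < c ->
  \sum_j expR (- (c * grid (M := M) j ^+ 2)) <= 2 / (1 - expR (- c)).
Proof.
move=> c0; pose rho := expR (- c).
have r0 : 0 < rho by exact: expR_gt0.
have r1 : rho < 1 by rewrite -expR0 ltr_expR oppr_lt0.
have geom n : \sum_(i < n) rho ^+ i <= (1 - rho)^-1.
  rewrite -[leRHS]mul1r ler_pdivlMr; last lra.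
  have -> : (\sum_(i < n) rho ^+ i) * (1 - rho) = 1 - rho ^+ n.
    by rewrite -[1 - rho]opprB mulrN mulrC -subrX1 opprB.
  by rewrite gerBl exprn_ge0// ltW.
rewrite -(pair_bigA _ (fun b (i : 'I_M.+1) => expR (- (c * grid (b, i) ^+ 2))))/=.
apply: (@le_trans _ _ (\sum_(b : bool) (1 - rho)^-1)); last first.
  by rewrite sumr_const card_bool mulr_natl.
apply: ler_sum => b _; apply: le_trans (geom M.+1); apply: ler_sum => i _.
rewrite /rho -expRM_natl ler_expR /grid /= exprMn sqrr_sign mul1r.
rewrite mulrN lerN2 mulrC ler_pM2l// -natrX ler_nat.
by rewrite -mulnn; case: (i : nat) => // n; exact: leq_pmulr.
Qed.

End Grid.

Lemma norm_deviation_le (R : realType) (q N : nat) (m : 'cV[R]_q) (x : coloring q N) (r : 'I_q) :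
  simplex m -> `|deviation m x r| <= N%:R.
Proof.
case=> m01 _; apply: le_trans (ler_norm_sum _ _ _) _.
rewrite -[N in leRHS]card_ord -sum1_card natr_sum; apply: ler_sum => i _.
have /andP[h0 h1] := m01 r; rewrite ler_norml.
by case: (x i == r) => /=; lra.
Qed.

(* A discrete Hubbard-Stratonovich transform: each factor
   exp (beta v^2 / 2) is dominated by a sum of exponentials linear in v over
   an integer grid, with Gaussian weights, and the subgaussian bound is applied inside. *)
Lemma exp_moment_bounded (R : realType) (q : nat) (m : 'cV[R]_q) (beta kappa : R) :
  0 < beta -> beta < kappa -> simplex m -> (forall r, 0 < m r 0) ->
  (forall t, simplex t -> kappa / 2 * sqdist t m <= relent t m) ->
  exists2 C : R, 0 < C & forall N : nat, (0 < N)%N ->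
    \sum_(x : coloring q N) (\prod_i m (x i) 0) *
       expR (beta / (2 * N%:R) * \sum_r deviation m x r ^+ 2) <= C.
Proof.
move=> b0 bk hm m0 hk.
have k0 : 0 < kappa := lt_trans b0 bk.
(* The net Gaussian decay: the grid weight has rate 1 / (2 beta) and the subgaussian bound gives
   back 1 / (2 kappa). *)
pose c := ((2 * beta)^-1 - (2 * kappa)^-1).
have c0 : 0 < c by rewrite subr_gt0 ltf_pV2 ?posrE; lra.
pose D := 2 / (1 - expR (- c)).
have D0 : 0 < D by rewrite divr_gt0// subr_gt0 -expR0 ltr_expR oppr_lt0.
exists ((expR (1 / (2 * beta)) * D) ^+ q) => [|N N0].
  by rewrite exprn_gt0// mulr_gt0// expR_gt0.
have N0' : 0 < N%:R :> R by rewrite ltr0n.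
pose s := Num.sqrt (N%:R : R).
have s2 : s ^+ 2 = N%:R by rewrite sqr_sqrtr// ltW.
have s0 : 0 < s by rewrite sqrtr_gt0.
have s1 : 1 <= s by rewrite -(@expr_ge1 _ 2)// ?s2 ?ler1n// ltW.
(* Since |deviation| <= N and s >= 1, beta v lies within beta N of 0. The grid grows with N, but
   [sum_grid_le] does not see its size. *)
pose M := Num.truncn (beta * N%:R).
pose J : finType := (bool * 'I_M.+1)%type.
pose K := expR (1 / (2 * beta)).
pose v (x : coloring q N) r := deviation m x r / s.
have vM x r : `|beta * v x r| < M.+1%:R.
  apply: (@le_lt_trans _ _ (beta * N%:R)).
    rewrite normrM (gtr0_norm b0) ler_pM2l// normrM normfV (gtr0_norm s0).
    rewrite ler_pdivrMr//; apply: le_trans (norm_deviation_le _ _ hm) _.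
    by rewrite ler_peMr// ltW.
  by have /andP[] := truncn_itv (ltW (mulr_gt0 b0 N0')).
have step (x : coloring q N) : expR (beta / (2 * N%:R) * \sum_r deviation m x r ^+ 2) <=
   K ^+ q * \sum_(f : {ffun 'I_q -> J})
      expR (- \sum_r grid R (f r) ^+ 2 / (2 * beta)) * expR (\sum_r (grid R (f r) / s) * deviation m x r).
  have -> : beta / (2 * N%:R) * \sum_r deviation m x r ^+ 2 = \sum_r beta / 2 * v x r ^+ 2.
    rewrite mulr_sumr; apply: eq_bigr => r _.
    by rewrite /v -s2; field; rewrite gt_eqF.
  rewrite expR_sum.
  apply: (@le_trans _ _ (\prod_r (K * \sum_(j : J) expR (grid R j * v x r - grid R j ^+ 2 / (2 * beta))))).
    by apply: ler_prod => r _; rewrite expR_ge0 expR_sqr_le_grid.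
  rewrite big_split/= prodr_const card_ord ler_wpM2l ?exprn_ge0 ?expR_ge0//.
  rewrite bigA_distr_bigA; apply: ler_sum => f _.
  rewrite -expR_sum -expRD ler_expR -sumrN -big_split/=.
  by apply: ler_sum => r _; rewrite /v; lra.
apply: (@le_trans _ _ (\sum_(x : coloring q N) (\prod_i m (x i) 0) *
   (K ^+ q * \sum_(f : {ffun 'I_q -> J})
      expR (- \sum_r grid R (f r) ^+ 2 / (2 * beta)) * expR (\sum_r (grid R (f r) / s) * deviation m x r)))).
  by apply: ler_sum => x _; rewrite ler_wpM2l ?step// prodr_ge0// => i _; rewrite ltW.
under eq_bigr do rewrite mulrCA mulr_sumr.
rewrite -mulr_sumr exchange_big/= exprMn ler_wpM2l ?exprn_ge0 ?expR_ge0//.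
apply: (@le_trans _ _ (\sum_(f : {ffun 'I_q -> J}) \prod_r expR (- (c * grid R (f r) ^+ 2)))).
  apply: ler_sum => f _.
  under eq_bigr do rewrite mulrCA.
  rewrite -mulr_sumr -expR_sum.
  apply: le_trans (ler_wpM2l (expR_ge0 _) (deviation_mgf_le _ (fun r => grid R (f r) / s) k0 hm m0 hk)) _.
  rewrite -expRD ler_expR mulr_sumr -sumrN -big_split/=; apply: ler_sum => r _.
  by rewrite expr_div_n s2 /c le_eqVlt; apply/orP; left; apply/eqP; field; rewrite !gt_eqF.
rewrite -(bigA_distr_bigA (fun (_ : 'I_q) (j : J) => expR (- (c * grid R j ^+ 2)))).
rewrite prodr_const card_ord lerXn2r ?nnegrE ?sum_grid_le ?(ltW D0)//.
by apply: sumr_ge0 => j _; exact: expR_ge0.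
Qed.

(** * Erdos-Renyi edges *)

Lemma sum_edges (R : realType) (N : nat) (F : 'I_N -> 'I_N -> R) :
  (forall i j, F i j = F j i) ->
  \sum_i \sum_j F i j = \sum_i F i i + 2 * \sum_(e : edge N) F (val e).1 (val e).2.
Proof.
move=> Fsym.
have edgeE : \sum_(e : edge N) F (val e).1 (val e).2 =
    \sum_(ij : 'I_N * 'I_N | (ij.1 < ij.2)%N) F ij.1 ij.2.
  rewrite (reindex_omap (val : edge N -> 'I_N * 'I_N) insub) => [|ij hij].
    by apply: eq_bigl => e; rewrite (valP e) valK eqxx.
  by rewrite insubT.
have swapE : \sum_(ij : 'I_N * 'I_N | (ij.2 < ij.1)%N) F ij.1 ij.2 =
    \sum_(ij : 'I_N * 'I_N | (ij.1 < ij.2)%N) F ij.1 ij.2.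
  rewrite (reindex_inj (h := fun ij : 'I_N * 'I_N => (ij.2, ij.1))) => [|[a b] [c d] /= [-> ->]//].
  by apply: eq_bigr => ij _; rewrite Fsym.
have diagE : \sum_(ij : 'I_N * 'I_N | ij.1 == ij.2) F ij.1 ij.2 = \sum_i F i i.
  rewrite -(pair_big_dep xpredT (fun i j => i == j) F)/=.
  by apply: eq_bigr => i _; rewrite (big_pred1 i)// => j; rewrite eq_sym.
rewrite pair_bigA/= (bigID (fun ij : 'I_N * 'I_N => ij.1 == ij.2))/= diagE; congr (_ + _).
rewrite (bigID (fun ij : 'I_N * 'I_N => (ij.1 < ij.2)%N))/= edgeE mulr_natl mulr2n.
congr (_ + _); first by apply: eq_bigl => ij; rewrite -val_eqE neq_ltn; case: ltngtP.
by rewrite -swapE; apply: eq_bigl => ij; rewrite -val_eqE neq_ltn; case: ltngtP.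
Qed.

Lemma adj_edge (N : nat) (G : graph N) (e : edge N) : adj G (val e).1 (val e).2 = G e.
Proof. by rewrite /adj -surjective_pairing valK. Qed.

Lemma adj_diag (N : nat) (G : graph N) (i : 'I_N) : adj G i i = false.
Proof. by rewrite /adj insubF//= ltnn. Qed.

Lemma adj_sym (N : nat) (G : graph N) (i j : 'I_N) : adj G i j = adj G j i.
Proof.
rewrite /adj; case: insubP => [e /= ij _|]; case: insubP => [f /= ji _|] //.
by move: ij ji => /ltnW; rewrite leqNgt => /negPf ->.
Qed.

Definition mono (q N : nat) (x : coloring q N) (e : edge N) : bool :=
  x (val e).1 == x (val e).2.

Lemma sum_mono (R : realType) (q N : nat) (x : coloring q N) :
  N%:R + 2 * \sum_e (mono x e)%:R = \sum_i \sum_j (x i == x j)%:R :> R.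
Proof.
rewrite (@sum_edges R N (fun i j => (x i == x j)%:R)) => [|i j]; last by rewrite eq_sym.
congr (_ + _); under eq_bigr do rewrite eqxx.
by rewrite sumr_const card_ord.
Qed.

Lemma sum_mono_le (R : realType) (q N : nat) (x : coloring q N) :
  \sum_e (mono x e)%:R <= N%:R ^+ 2 :> R.
Proof.
have : \sum_i \sum_j (x i == x j)%:R <= N%:R ^+ 2 :> R.
  have cardN : \sum_(i < N) 1 = N%:R :> R by rewrite sumr_const card_ord.
  rewrite expr2 -{1}cardN mulr_suml; apply: ler_sum => i _.
  by rewrite mul1r -cardN; apply: ler_sum => j _; case: (x i == x j).
rewrite -sum_mono.
have : 0 <= \sum_(e : edge N) (mono x e)%:R :> R by apply: sumr_ge0.
have : 0 <= N%:R :> R by [].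
lra.
Qed.

(** Each edge occurs twice in the double sum, which cancels the factor 1/2, and the diagonal is
    zero. *)
Lemma potts_weightE (R : realType) (p : R) (q N : nat) (theta : R * 'cV[R]_q.-1)
    (G : graph N) (x : coloring q N) :
  potts_weight p theta G x =
  expR (theta.1 / (N%:R * p) * \sum_e (G e)%:R * (mono x e)%:R
        + \sum_i field_coord theta.2 (x i)).
Proof.
rewrite /potts_weight; congr (expR (_ + _)); last first.
  by apply: eq_bigr => i _; rewrite sum_mul_eq.
rewrite (@sum_edges R N (fun i j => coupling p G i j * (x i == x j)%:R)) => [|i j]; last first.
  by rewrite /coupling adj_sym eq_sym.
rewrite big1 ?add0r => [|i _]; last by rewrite /coupling adj_diag !mul0r.
rewrite mulrA divfK// 2!mulr_sumr; apply: eq_bigr => e _.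
by rewrite /coupling adj_edge /mono; ring.
Qed.

Lemma er_pmf_ge0 (R : realType) (p : R) (N : nat) (G : graph N) :
  0 <= p <= 1 -> 0 <= er_pmf p G.
Proof. by move=> hp; apply: prodr_ge0 => e _; case: ifP; lra. Qed.

Lemma er_pmf_expect (R : realType) (p : R) (N : nat) (h : edge N -> bool -> R) :
  \sum_(G : graph N) er_pmf p G * \prod_e h e (G e)
  = \prod_e (p * h e true + (1 - p) * h e false).
Proof.
rewrite (eq_bigr (fun e => \sum_(b : bool) (if b then p else 1 - p) * h e b)); last first.
  by move=> e _; rewrite big_bool.
by rewrite bigA_distr_bigA; apply: eq_bigr => G _; rewrite -big_split.
Qed.

Lemma sum_er_pmf (R : realType) (p : R) (N : nat) : \sum_(G : graph N) er_pmf p G = 1.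
Proof.
have := er_pmf_expect p (fun _ : edge N => fun=> 1).
rewrite (eq_bigr (@er_pmf R p N)) => [->|G _]; last by rewrite big1_eq mulr1.
by rewrite big1// => e _; ring.
Qed.

(** One selected edge contributes 1 - p + p exp a <= 1 + p (a + a^2) <= exp (p a + p a^2). For a of
    order 1 / N the quadratic part stays bounded when summed over all edges. *)
Lemma er_mgf_le (R : realType) (p a : R) (N : nat) (c : edge N -> bool) :
  0 <= p <= 1 -> a <= 1 / 3 ->
  \sum_(G : graph N) er_pmf p G * expR (a * \sum_e (G e)%:R * (c e)%:R)
  <= expR ((p * a + p * a ^+ 2) * \sum_e (c e)%:R).
Proof.
move=> hp ha.
under eq_bigr do rewrite mulr_sumr expR_sum.
rewrite (er_pmf_expect p (fun e b => expR (a * (b%:R * (c e)%:R)))) mulr_sumr expR_sum.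
apply: ler_prod => e _; apply/andP; split.
  by rewrite addr_ge0// mulr_ge0 ?expR_ge0//; lra.
rewrite mul0r mulr0 expR0; case: (c e); last by rewrite !mulr0 expR0; lra.
rewrite !mulr1; apply: le_trans (expR_ge1Dx _).
by have := expR_le_quadratic ha; nra.
Qed.

(** * Contiguity *)

Lemma sum_prod_simplex (R : realType) (q N : nat) (m : 'cV[R]_q) : simplex m ->
  \sum_(x : coloring q N) \prod_i m (x i) 0 = 1.
Proof.
by case=> _ m1; rewrite -(bigA_distr_bigA (fun (_ : 'I_N) a => m a 0)) big1.
Qed.

Lemma sum_er_product (R : realType) (p : R) (q N : nat) (m : 'cV[R]_q) : simplex m ->
  \sum_(w : sample q N) er_product p m w = 1.
Proof.
move=> hm.
rewrite -(pair_bigA _ (fun (x : coloring q N) (G : graph N) => (\prod_i m (x i) 0) * er_pmf p G))/=.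
by under eq_bigr do rewrite -mulr_sumr sum_er_pmf mulr1; rewrite sum_prod_simplex.
Qed.

(** For fixed eps the term K P(S_N) tends to 0, and eps is arbitrary. Uniformity in S lets the bound
    be used at the moving event S_N. *)
Lemma contiguous_of_bound (R : realType) (T : nat -> finType) (Q P : forall N, T N -> R) :
  (forall N w, 0 <= Q N w) ->
  (forall eps : R, 0 < eps -> exists2 K : R, 0 < K &
     \forall N \near \oo, forall S : {set T N}, prob (Q N) S <= K * prob (P N) S + eps) ->
  contiguous Q P.
Proof.
move=> Q0 h S /cvgr0Pnorm_lt PS; apply/cvgr0Pnorm_lt => e e0.
have e20 : 0 < e / 2 by lra.
have [K K0 hK] := h _ e20.
have eK : 0 < e / 2 / K by rewrite !divr_gt0.
near=> N.
rewrite ger0_norm; last by apply: sumr_ge0.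
have h1 : prob (Q N) (S N) <= K * prob (P N) (S N) + e / 2.
  by move: (S N); near: N.
have h2 : `|prob (P N) (S N)| < e / 2 / K by near: N; exact: PS.
move: h2; rewrite ltr_pdivlMr// mulrC => h2.
have := ler_wpM2l (ltW K0) (ler_norm (prob (P N) (S N))); lra.
Unshelve. all: by end_near. Qed.

Section Contiguity.
Variables (R : realType) (q : nat) (p : R) (m : 'cV[R]_q) (theta : R * 'cV[R]_q.-1).
Hypotheses (hp : 0 < p <= 1) (hTh : Theta m theta).

Let b0 : 0 < theta.1. Proof. by case: hTh. Qed.
Let hmax : global_maximizer theta m. Proof. by case: hTh => _ []. Qed.
Let hm : simplex m. Proof. by case: hmax. Qed.
Let m0 : forall r, 0 < m r 0. Proof. exact: maximizer_pos hmax. Qed.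

(** The Lagrange multiplier of the constraint of total mass 1, obtained by testing stationarity
    against e_r - e_s. *)
Lemma gradH_const : exists l : R, forall r, gradH theta m r = l.
Proof.
have [/existsP[s _]|] := boolP [exists s : 'I_q, true]; last first.
  by move=> /existsPn h; exists 0 => r; have := h r.
exists (gradH theta m s) => r.
pose u : 'cV[R]_q := \col_k ((r == k)%:R - (s == k)%:R).
have sumd (f : 'I_q -> R) : \sum_k f k * u k 0 = f r - f s.
  by under eq_bigr do rewrite mxE mulrBr; rewrite sumrB !sum_mul_eq.
apply/eqP; rewrite -subr_eq0 -sumd; apply/eqP; apply: maximizer_stationary => //.
by have := sumd (fun=> 1); rewrite subrr; under eq_bigr do rewrite mul1r.
Qed.

(* Stationarity of m cancels the terms linear in the deviation. *)
Lemma mean_field_weight : exists h : R, forall (N : nat) (x : coloring q N), (0 < N)%N ->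
  expR (theta.1 / N%:R * \sum_e (mono x e)%:R + \sum_i field_coord theta.2 (x i)) =
  expR h ^+ N * expR (- (theta.1 / 2)) * (\prod_i m (x i) 0) *
    expR (theta.1 / (2 * N%:R) * \sum_r deviation m x r ^+ 2).
Proof.
have [l hl] := gradH_const.
exists (l - theta.1 / 2 * \sum_r m r 0 ^+ 2) => N x N0.
have Nn0 : N%:R != 0 :> R by rewrite pnatr_eq0 -lt0n.
rewrite -expRM_natl -expRD.
have -> : \prod_i m (x i) 0 = expR (\sum_i ln (m (x i) 0)).
  by rewrite expR_sum; apply: eq_bigr => i _; rewrite lnK// posrE.
rewrite -!expRD; congr expR.
pose cnt r : R := \sum_i (x i == r)%:R.
have devE r : deviation m x r = cnt r - N%:R * m r 0.
  by rewrite /deviation sumrB sumr_const card_ord mulr_natl.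
(* The N diagonal pairs in this count are the source of the factor exp (- beta / 2). *)
have monoE : N%:R + 2 * \sum_e (mono x e)%:R = \sum_r cnt r ^+ 2.
  rewrite sum_mono.
  have -> : \sum_r cnt r ^+ 2 = \sum_i \sum_j \sum_r (x i == r)%:R * (x j == r)%:R.
    under eq_bigr do rewrite expr2 mulr_suml.
    rewrite exchange_big; apply: eq_bigr => i _ /=.
    under eq_bigr do rewrite mulr_sumr.
    by rewrite exchange_big.
  apply: eq_bigr => i _; apply: eq_bigr => j _.
  by rewrite (sum_mul_eq (fun r => (x i == r)%:R)).
have fieldE : \sum_i field_coord theta.2 (x i) =
    N%:R * l - theta.1 * \sum_r cnt r * m r 0 + \sum_i ln (m (x i) 0).
  have -> : \sum_r cnt r * m r 0 = \sum_i m (x i) 0.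
    under eq_bigr do rewrite mulr_suml.
    rewrite exchange_big; apply: eq_bigr => i _ /=.
    by under eq_bigr do rewrite mulrC; rewrite (sum_mul_eq (fun r => m r 0)).
  have -> : N%:R * l = \sum_(i < N) l by rewrite sumr_const card_ord mulr_natl.
  rewrite mulr_sumr -sumrB -big_split; apply: eq_bigr => i _ /=.
  by rewrite -(hl (x i)) /gradH; ring.
have sqE : \sum_r deviation m x r ^+ 2 = \sum_r cnt r ^+ 2 -
    2 * N%:R * \sum_r cnt r * m r 0 + N%:R ^+ 2 * \sum_r m r 0 ^+ 2.
  rewrite !mulr_sumr -sumrB -big_split; apply: eq_bigr => r _ /=.
  by rewrite devE; ring.
rewrite fieldE sqE -monoE; by field.
Qed.

(** A Markov argument. The likelihood ratio is exp (a Y) A [Rx] / Z with [Rx] >= 1. Unless dl Z >=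
    [Zb] or dl exp (- a Y) >= 1, it is at least dl^2 / (C exp D); these exceptions have product
    measure at most dl and dl exp D. *)
Lemma er_product_bound (eps : R) : 0 < eps -> exists2 K : R, 0 < K &
  \forall N \near \oo, forall S : {set sample q N},
    prob (er_product p m (N := N)) S <= K * prob (er_potts p theta (N := N)) S + eps.
Proof.
move=> eps0.
have /andP[p0 p1] := hp.
have hp' : 0 <= p <= 1 by rewrite ltW.
have [kappa bk hk] := relent_gap hTh.
have [C C0 hC] := exp_moment_bounded b0 bk hm m0 hk.
have [h hmf] := mean_field_weight.
(* D is p a^2 N^2 for a = beta / (N p), a bound on the quadratic term of the edge moment. *)
pose D := theta.1 ^+ 2 / p.
have [dl dl0 hdl] : exists2 dl : R, 0 < dl & dl * (1 + expR D) <= eps.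
  have D1 : 0 < 1 + expR D by rewrite ltr_wpDl ?expR_gt0.
  by exists (eps / (1 + expR D)); rewrite ?divr_gt0// divfK// gt_eqF.
exists (expR D * C / dl ^+ 2); first by rewrite divr_gt0 ?mulr_gt0 ?expR_gt0 ?exprn_gt0.
near=> N.
have N0 : (0 < N)%N by near: N; exact: nbhs_infty_gt.
have N0' : 0 < N%:R :> R by rewrite ltr0n.
have Nn0 : N%:R != 0 :> R by rewrite gt_eqF.
pose a := theta.1 / (N%:R * p).
have a0 : 0 < a by rewrite divr_gt0// mulr_gt0.
have a13 : a <= 1 / 3.
  rewrite ler_pdivrMr ?mulr_gt0//.
  have : 3 * theta.1 / p <= N%:R by near: N; exact: nbhs_infty_ger.
  rewrite ler_pdivrMr//; lra.
have paE : p * a = theta.1 / N%:R by rewrite /a; field; rewrite Nn0 gt_eqF.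
pose nm (x : coloring q N) : R := \sum_e (mono x e)%:R.
have a2D x : p * a ^+ 2 * nm x <= D.
  have -> : D = p * a ^+ 2 * N%:R ^+ 2 by rewrite /D /a; field; rewrite Nn0 gt_eqF.
  by rewrite ler_wpM2l ?sum_mono_le// mulr_ge0 ?sqr_ge0 ?ltW.
pose A := expR h ^+ N * expR (- (theta.1 / 2)).
have A0 : 0 < A by rewrite mulr_gt0 ?exprn_gt0 ?expR_gt0.
pose P0 (x : coloring q N) := \prod_i m (x i) 0.
have P00 x : 0 <= P0 x by apply: prodr_ge0 => i _; rewrite ltW.
pose Rx (x : coloring q N) := expR (theta.1 / (2 * N%:R) * \sum_r deviation m x r ^+ 2).
have Rx1 x : 1 <= Rx x.
  rewrite -expR0 ler_expR mulr_ge0 ?divr_ge0 ?mulr_ge0 ?(ltW b0) ?(ltW N0')//.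
  by apply: sumr_ge0 => r _; rewrite sqr_ge0.
pose Y (x : coloring q N) (G : graph N) : R := \sum_e (G e)%:R * (mono x e)%:R - p * nm x.
have WE x G : potts_weight p theta G x = expR (a * Y x G) * (A * P0 x * Rx x).
  rewrite potts_weightE -/a /A /P0 /Rx -hmf// -expRD; congr expR.
  rewrite -paE /Y /nm; ring.
have er0 (G : graph N) : 0 <= er_pmf p G by exact: er_pmf_ge0.
(* A bound on the annealed partition function. Its factor A, which depends on N, cancels in the
   likelihood ratio. *)
pose Zb := expR D * A * C.
have Zb0 : 0 < Zb := mulr_gt0 (mulr_gt0 (expR_gt0 D) A0) C0.
(* Used with s = a for the mean of Z and with s = - a for the lower tail of Y. *)
have EY (s : R) (x : coloring q N) : s <= 1 / 3 -> s ^+ 2 = a ^+ 2 ->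
    \sum_(G : graph N) er_pmf p G * expR (s * Y x G) <= expR D.
  move=> s13 s2.
  have -> : \sum_(G : graph N) er_pmf p G * expR (s * Y x G) =
     (\sum_(G : graph N) er_pmf p G * expR (s * \sum_e (G e)%:R * (mono x e)%:R)) * expR (- (s * p * nm x)).
    rewrite mulr_suml; apply: eq_bigr => G _.
    by rewrite -mulrA -expRD /Y mulrBr !mulrA.
  apply: le_trans (ler_wpM2r (expR_ge0 _) (er_mgf_le (mono x) hp' s13)) _.
  rewrite -expRD ler_expR -/(nm x) s2.
  by have := a2D x; lra.
have EZ : \sum_(G : graph N) er_pmf p G * potts_Z p theta G <= Zb.
  under eq_bigr do rewrite mulr_sumr.
  rewrite exchange_big/=.
  apply: (@le_trans _ _ (\sum_(x : coloring q N) expR D * A * (P0 x * Rx x))).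
    apply: ler_sum => x _.
    under eq_bigr do rewrite WE mulrA.
    rewrite -mulr_suml -!mulrA [leRHS]mulrA; rewrite -[leRHS]mulrA.
    apply: ler_wpM2r (EY a x a13 erefl).
    by rewrite !mulr_ge0 ?expR_ge0 ?(ltW A0).
  by rewrite -mulr_sumr ler_wpM2l ?hC// mulr_ge0 ?expR_ge0 ?(ltW A0).
(* Either Z is atypically large, or the edge fluctuation Y is atypically
   negative, or the likelihood ratio is bounded below. *)
have pt (w : sample q N) : er_product p m w <= expR D * C / dl ^+ 2 * er_potts p theta w
   + (er_product p m w * (dl * (potts_Z p theta w.2 / Zb)) + er_product p m w * (dl * expR (- a * Y w.1 w.2))).
  case: w => x G; rewrite /er_product /er_potts /= -/(P0 x).
  set Z := potts_Z p theta G; set e := er_pmf p G.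
  have W0 : 0 < potts_weight p theta G x by exact: expR_gt0.
  have Z0 : 0 < Z.
    apply: lt_le_trans W0 _; rewrite /Z /potts_Z (bigD1 x)//= lerDl.
    by apply: sumr_ge0 => y _; exact: expR_ge0.
  have e0 : 0 <= e by exact: er0.
  have Pe0 : 0 <= P0 x * e by rewrite mulr_ge0.
  have t10 : 0 <= expR D * C / dl ^+ 2 * (e * (potts_weight p theta G x / Z)).
    by rewrite !mulr_ge0 ?invr_ge0 ?exprn_ge0 ?expR_ge0// ltW.
  have t20 : 0 <= P0 x * e * (dl * (Z / Zb)).
    by rewrite !mulr_ge0 ?invr_ge0// ltW.
  have t30 : 0 <= P0 x * e * (dl * expR (- a * Y x G)).
    by rewrite !mulr_ge0 ?expR_ge0// ltW.
  have [h2|h2] := lerP 1 (dl * (Z / Zb)).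
    by have := ler_wpM2l Pe0 h2; lra.
  have [h3|h3] := lerP 1 (dl * expR (- a * Y x G)).
    by have := ler_wpM2l Pe0 h3; lra.
  suff : P0 x * e <= expR D * C / dl ^+ 2 * (e * (potts_weight p theta G x / Z)) by lra.
  have -> : expR D * C / dl ^+ 2 * (e * (potts_weight p theta G x / Z)) =
      expR D * C * potts_weight p theta G x / (dl ^+ 2 * Z) * e.
    by field; rewrite !gt_eqF.
  apply: ler_wpM2r => //; rewrite ler_pdivlMr ?mulr_gt0 ?exprn_gt0//.
  rewrite WE.
  have dlE : dl <= expR (a * Y x G).
    by move: h3; rewrite mulNr expRN ltr_pdivrMr ?expR_gt0// mul1r => /ltW.
  have dlZ : dl * Z <= Zb by move: h2; rewrite mulrA ltr_pdivrMr// mul1r => /ltW.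
  have -> : P0 x * (dl ^+ 2 * Z) = P0 x * dl * (dl * Z) by ring.
  apply: (@le_trans _ _ (P0 x * dl * Zb)).
    by apply: ler_wpM2l dlZ; rewrite mulr_ge0// ltW.
  have -> : P0 x * dl * Zb = expR D * C * A * P0 x * (dl * 1) by rewrite /Zb; ring.
  have -> : expR D * C * (expR (a * Y x G) * (A * P0 x * Rx x)) =
     expR D * C * A * P0 x * (expR (a * Y x G) * Rx x) by ring.
  apply: ler_wpM2l; first by rewrite !mulr_ge0 ?expR_ge0// ltW.
  by apply: ler_pM => //; exact: ltW.
move=> S; rewrite /prob.
apply: le_trans (ler_sum _ (fun w _ => pt w)) _.
rewrite big_split/= -mulr_sumr lerD2l.
apply: le_trans hdl.
have Zpos (G : graph N) : 0 <= potts_Z p theta G.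
  by apply: sumr_ge0 => y _; exact: expR_ge0.
(* The error terms are nonnegative, so the sum over S may be enlarged to all samples, which makes
   the bound uniform in S. *)
apply: (@le_trans _ _ (\sum_(w : sample q N) (er_product p m w * (dl * (potts_Z p theta w.2 / Zb))
    + er_product p m w * (dl * expR (- a * Y w.1 w.2))))).
  rewrite [leLHS]big_mkcond; apply: ler_sum => -[x G] _; case: ifP => // _.
  rewrite /er_product /= -/(P0 x).
  by rewrite addr_ge0 ?mulr_ge0 ?invr_ge0 ?expR_ge0// ltW.
rewrite -(pair_bigA _ (fun (x : coloring q N) (G : graph N) =>
  P0 x * er_pmf p G * (dl * (potts_Z p theta G / Zb)) + P0 x * er_pmf p G * (dl * expR (- a * Y x G))))/=.
have -> : dl * (1 + expR D) = \sum_(x : coloring q N) P0 x * (dl * (1 + expR D)).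
  by rewrite -mulr_suml sum_prod_simplex// mul1r.
apply: ler_sum => x _.
have -> : \sum_(G : graph N) (P0 x * er_pmf p G * (dl * (potts_Z p theta G / Zb))
    + P0 x * er_pmf p G * (dl * expR (- a * Y x G))) =
  P0 x * (dl * ((\sum_(G : graph N) er_pmf p G * potts_Z p theta G) / Zb +
     \sum_(G : graph N) er_pmf p G * expR (- a * Y x G))).
  rewrite mulr_suml -big_split !mulr_sumr; apply: eq_bigr => G _ /=; ring.
apply: ler_wpM2l => //; apply: ler_wpM2l; first exact: ltW.
apply: lerD; first by rewrite ler_pdivrMr// mul1r.
by apply: EY; rewrite ?sqrrN//; lra.
Unshelve. all: by end_near. Qed.

Lemma er_product_contiguous : contiguous (er_product p m) (er_potts p theta).
Proof.
have hp' : 0 <= p <= 1 by case/andP: hp => /ltW -> ->.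
apply: contiguous_of_bound => [N w|eps eps0]; last exact: er_product_bound.
by rewrite mulr_ge0 ?er_pmf_ge0// prodr_ge0// => i _; rewrite ltW.
Qed.

End Contiguity.

(** * Impossibility of consistent estimation *)

Lemma no_common_consistent_estimator (R : realType) (T : nat -> finType) (V : normedModType R)
    (Q P1 P2 : forall N, T N -> R) (X : forall N, T N -> V) (l1 l2 : V) :
  (forall N w, 0 <= Q N w) -> (forall N, \sum_w Q N w = 1) ->
  contiguous Q P1 -> contiguous Q P2 -> l1 != l2 ->
  cvg_in_prob P1 X l1 -> cvg_in_prob P2 X l2 -> False.
Proof.
move=> Q0 Q1 c1 c2 l12 X1 X2.
(* No point is within less than half the distance of both limits, so the two deviation events cover
   the space, yet eventually each has Q-mass below 1/2. *)
pose e := `|l1 - l2| / 2.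
have e0 : 0 < e by rewrite divr_gt0// normr_gt0 subr_eq0.
have /cvgr0Pnorm_lt/(_ _ (_ : 0 < 1 / 2)) h1 := c1 _ (X1 e e0).
have /cvgr0Pnorm_lt/(_ _ (_ : 0 < 1 / 2)) h2 := c2 _ (X2 e e0).
have half : 0 < 1 / 2 :> R by lra.
have [N [{}h1 {}h2]] := filter_ex (filterI (h1 half) (h2 half)).
set S1 := finset _ in h1; set S2 := finset _ in h2.
have cover w : (w \in S1) || (w \in S2).
  rewrite !inE; apply: contraT; rewrite negb_or -!ltNge => /andP[d1 d2].
  have := ler_distD (X N w) l1 l2; rewrite (distrC l1 (X N w)).
  by move: d1 d2; rewrite /e; lra.
have : 1 <= prob (Q N) S1 + prob (Q N) S2.
  rewrite -(Q1 N) /prob [X in X + _]big_mkcond [X in _ + X]big_mkcond -big_split.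
  apply: ler_sum => w _ /=; have := cover w; have := Q0 N w.
  by case: (w \in S1); case: (w \in S2) => //=; lra.
move: h1 h2; rewrite !ltr_norml; lra.
Qed.

Theorem theorem1p5 (R : realType) (q : nat) (hq : (2 <= q)%N)
    (p : R) (hp : 0 < p <= 1) (m : 'cV[R]_q) (hm : simplex m) :
  (forall theta : R * 'cV[R]_q.-1, Theta m theta ->
     contiguous (er_product p m) (er_potts p theta))
  /\
  ((exists theta1 theta2 : R * 'cV[R]_q.-1,
      [/\ Theta m theta1, Theta m theta2 & theta1 <> theta2]) ->
   ~ exists est : forall N : nat, sample q N -> R * 'cV[R]_q.-1,
       consistent p m est).
Proof.
have ctg theta : Theta m theta -> contiguous (er_product p m) (er_potts p theta).
  exact: er_product_contiguous.
split=> // -[t1 [t2 [h1 h2 /eqP h12]]] [est hest].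
have hp' : 0 <= p <= 1 by case/andP: hp => /ltW -> ->.
apply: (no_common_consistent_estimator _ _ (ctg _ h1) (ctg _ h2) h12 (hest _ h1) (hest _ h2)).
- move=> N w; rewrite mulr_ge0 ?er_pmf_ge0// prodr_ge0// => i _.
  exact: simplex_ge0.
- by move=> N; exact: sum_er_product.
Qed.
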